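(* Let $f:\{0,1\}^n\to\{0,1\}$ be a non-constant Boolean function. Then \[ C_1(f) \geq \frac{3}{2}\,\frac{bs_0(f)}{s_0(f)} - \frac{1}{2}. \]
   Context: For $x\in\{0,1\}^n$ and $S\subseteq[n]$, $x^S$ denotes $x$ with all bits in $S$ flipped. The sensitivity $s(f,x)$ is the number of $i\in[n]$ with $f(x)\neq f(x^{\{i\}})$, and $s_0(f)=\max\{s(f,x): f(x)=0\}$. The block sensitivity $bs(f,x)$ is the maximum number $b$ of pairwise disjoint sets $B_1,\dots,B_b\subseteq[n]$ with $f(x^{B_j})\neq f(x)$ for all $j$, and $bs_0(f)=\max\{bs(f,x): f(x)=0\}$. A certificate is a partial assignment $c:S\to\{0,1\}$, $S\subseteq[n]$, such that $f$ is constant on all inputs agreeing with $c$ on $S$; it is a 1-certificate if that constant is 1; its length is $|S|$. $C(f,x)$ is the minimum length of a certificate satisfied by $x$ (i.e. agreeing with $x$ on its domain), and $C_1(f)=\max\{C(f,x): f(x)=1\}$. *)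

(* Defs.v *)
From mathcomp Require Import all_boot all_order all_algebra.
Set Implicit Arguments. Unset Strict Implicit. Unset Printing Implicit Defensive.

Definition input (n : nat) := {ffun 'I_n -> bool}.

Definition flip n (x : input n) (S : {set 'I_n}) : input n :=
  [ffun i => if i \in S then ~~ x i else x i].

Section Measures.
Variables (n : nat) (f : input n -> bool).

Definition sens (x : input n) : nat :=
  #|[set i : 'I_n | f (flip x [set i]) != f x]|.

Definition s0 : nat := \max_(x : input n | ~~ f x) sens x.

Definition sens_blocks (x : input n) (P : {set {set 'I_n}}) : bool :=
  trivIset P && [forall B in P, f (flip x B) != f x].

Definition bsens (x : input n) : nat :=
  \max_(P : {set {set 'I_n}} | sens_blocks x P) #|P|.

Definition bs0 : nat := \max_(x : input n | ~~ f x) bsens x.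

(* S (with the values of x on S) is a certificate satisfied by x *)
Definition is_cert (x : input n) (S : {set 'I_n}) : bool :=
  [forall y : input n, [forall i in S, y i == x i] ==> (f y == f x)].

(* C(f,x) : minimum length of a certificate satisfied by x
   (S = [set: 'I_n] is always one, so n is a valid top element) *)
Definition cert (x : input n) : nat :=
  \big[minn/n]_(S : {set 'I_n} | is_cert x S) #|S|.

Definition C1 : nat := \max_(x : input n | f x) cert x.

End Measures.

(* Main.v *)
Require Import Defs.
From mathcomp Require Import all_boot all_order all_algebra.
From mathcomp Require Import zify lra.
Import Order.TTheory GRing.Theory Num.Theory.
Local Open Scope ring_scope.

(** Let [x] be a 0-input with [k = bs0 f] disjoint sensitive blocks [B_i], and
let [S_i] be a shortest certificate of [x] flipped on [B_i].  Two blocks conflict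
with weight [d i j = |S_i :&: B_j| + |S_j :&: B_i|]; the total weight over
unordered pairs is at most [k (C1 f - 1)].

If all weighted degrees inside a set [T] of blocks are at most 2, every
conflicting coordinate can be charged to one of the two certificates it
involves, each certificate being charged at most once.  Flipping in [x] the
coordinates of the blocks of [T], except those charged to their own block, gives
an input violating each certificate of [T] in at most one position, and these
positions are distinct; a maximal 0-input below it has sensitivity at least
[|T|], hence [|T| <= s0 f].

Every set of blocks contains such a [T] to which all its remaining blocks are
joined by weight at least 3.  Removing [T] and iterating, as in the proof of
Turan's theorem, gives total weight at least [3/2 (k^2 / s0 f - k)]. *)

(** * Orientations of multigraphs of maximum degree two *)

(** The indices in [A] are edges with ends [u k] and [v k], a loop counting twice. Components of
    maximum degree 2 are paths and cycles, which can be oriented so that no two edges share a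
    head. *)
Lemma injective_endpoints (K T : finType) (A : {set K}) (u v : K -> T) :
  (forall t, (\sum_(k in A) ((u k == t) + (v k == t)) <= 2)%N) ->
  exists h : K -> T,
    {in A, forall k, (h k == u k) || (h k == v k)} /\ {in A &, injective h}.
Proof.
elim: {A}#|A| {-2}A (erefl #|A|) u v => [|m IHm] A cardA u v deg.
  have A0 : A = set0 by apply/eqP; rewrite -cards_eq0 cardA.
  by exists u; split=> [k|k k']; rewrite A0 inE.
have [k0 k0A] : exists k, k \in A by apply/card_gt0P; rewrite cardA.
have cardA0 : #|A :\ k0| = m by move: (cardsD1 k0 A); rewrite k0A cardA; lia.
have degD t : (\sum_(k in A :\ k0) ((u k == t) + (v k == t)) +
    ((u k0 == t) + (v k0 == t)) <= 2)%N.
  by move: (deg t); rewrite (big_setD1 k0) //= addnC.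
have [/exists_inP[k1 k1A end1]|/exists_inPn noend] := boolP [exists k in A :\ k0,
    (u k == u k0) || (v k == u k0)].
- (* The other edge at [u k0] and [k0] are merged into one edge [k1]. *)
  set a := u k0 in end1 *; set b := v k0.
  pose c := if u k1 == a then v k1 else u k1.
  pose u' k := if k == k1 then b else u k.
  pose v' k := if k == k1 then c else v k.
  have degM t : (\sum_(k in A :\ k0) ((u' k == t) + (v' k == t)) + (a == t).*2
      <= 2)%N.
    have sameN : (\sum_(k in A :\ k0 :\ k1) ((u' k == t) + (v' k == t)) =
        \sum_(k in A :\ k0 :\ k1) ((u k == t) + (v k == t)))%N.
      by apply: eq_bigr => k; rewrite /u' /v' !inE => /andP[/negbTE ->].
    move: (degD t); rewrite !(big_setD1 k1 k1A) /= sameN /u' /v' eqxx.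
    rewrite -/a -/b; suff -> : ((u k1 == t) + (v k1 == t) = (a == t) + (c == t))%N by lia.
    rewrite /c; case: eqP end1 => [->|_ /=] //; move=> /eqP ->; by rewrite addnC.
  have deg' t : (\sum_(k in A :\ k0) ((u' k == t) + (v' k == t)) <= 2)%N.
    by move: (degM t); lia.
  have [h [hend hinj]] := IHm _ cardA0 u' v' deg'.
  have hNa k : k \in A :\ k0 -> h k != a.
    move=> kA; apply/negP => /eqP hka; move: (degM a).
    rewrite eqxx (big_setD1 k) //=; move: (hend k kA).
    by rewrite hka ![a == _]eq_sym; lia.
  have endc : (c == u k1) || (c == v k1) by rewrite /c; case: ifP; rewrite eqxx ?orbT.
  have enda : (a == u k1) || (a == v k1) by rewrite ![a == _]eq_sym.
  have hendN k : k \in A -> k != k0 -> k != k1 -> (h k == u k) || (h k == v k).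
    move=> kA kN0 kN1; have := hend k; rewrite !inE kN0 kA => /(_ isT).
    by rewrite /u' /v' (negbTE kN1).
  have h1 := hend k1 k1A; rewrite /u' /v' eqxx in h1.
  (* Unmerging frees [a]. If the merged edge has head [b], then [k0] inherits [b] and [k1] takes
     [a]; otherwise [k1] keeps the head [c] and [k0] takes [a]. *)
  have [hb|hNb] := eqVneq (h k1) b.
    pose g k := if k == k0 then b else if k == k1 then a else h k.
    have ab : b != a by rewrite -hb hNa.
    have hNb k : k \in A -> k != k0 -> k != k1 -> h k != b.
      move=> kA kN0 kN1; rewrite -hb; apply: contra kN1 => /eqP/hinj ->//.
      by rewrite !inE kN0.
    exists g; split=> [k kA|k k' kA k'A]; rewrite /g.
      case: (eqVneq k k0) => [->|kN0]; first by rewrite eqxx orbT.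
      by case: (eqVneq k k1) => [->//|kN1]; apply: hendN.
    have hD l : l \in A -> l != k0 -> h l != a by move=> lA lN; apply: hNa; rewrite !inE lN.
    case: (eqVneq k k0) => [->|kN0]; case: (eqVneq k' k0) => [->|k'N0] //;
      try case: (eqVneq k k1) => [->|kN1]; try case: (eqVneq k' k1) => [->|k'N1];
      move=> // e.
    + by rewrite e eqxx in ab.
    + by have := hNb _ k'A k'N0 k'N1; rewrite -e eqxx.
    + by rewrite e eqxx in ab.
    + by have := hNb _ kA kN0 kN1; rewrite e eqxx.
    + by have := hD _ k'A k'N0; rewrite -e eqxx.
    + by have := hD _ kA kN0; rewrite e eqxx.
    + by apply: hinj => //; rewrite !inE ?kN0 ?k'N0.
  exists (fun k => if k == k0 then a else h k); split=> [k kA|k k' kA k'A].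
    case: (eqVneq k k0) => [->|kN0]; first by rewrite eqxx.
    case: (eqVneq k k1) => [->|kN1]; last exact: hendN.
    by move: h1; rewrite (negbTE hNb) => /eqP ->.
  have hD l : l \in A -> l != k0 -> h l != a by move=> lA lN; apply: hNa; rewrite !inE lN.
  case: (eqVneq k k0) => [->|kN0]; case: (eqVneq k' k0) => [->|k'N0] // e.
  + by have := hD _ k'A k'N0; rewrite -e eqxx.
  + by have := hD _ kA kN0; rewrite e eqxx.
  + by apply: hinj => //; rewrite !inE ?kN0 ?k'N0.
(* No other edge meets [u k0], so [k0] can take it. *)
have deg' t : (\sum_(k in A :\ k0) ((u k == t) + (v k == t)) <= 2)%N.
  by move: (degD t); lia.
have [h [hend hinj]] := IHm _ cardA0 u v deg'.
have hD l : l \in A -> l != k0 -> h l != u k0.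
  move=> lA lN; have lA0 : l \in A :\ k0 by rewrite !inE lN.
  by have /norP[] := noend _ lA0; case/orP: (hend _ lA0) => /eqP ->.
exists (fun k => if k == k0 then u k0 else h k); split=> [k kA|k k' kA k'A].
  case: (eqVneq k k0) => [->|kN0]; first by rewrite eqxx.
  by apply: hend; rewrite !inE kN0.
case: (eqVneq k k0) => [->|kN0]; case: (eqVneq k' k0) => [->|k'N0] // e.
+ by have := hD _ k'A k'N0; rewrite -e eqxx.
+ by have := hD _ kA kN0; rewrite e eqxx.
+ by apply: hinj => //; rewrite !inE ?kN0 ?k'N0.
Qed.

(** * A weighted Turan inequality *)

Section WeightedTuran.
Variables (I : finType) (d : I -> I -> nat) (s : nat) (P : {set I}).
Hypothesis d_sym : forall i j, d i j = d j i.
Hypothesis d_diag : forall i, d i i = 0%N.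
Hypothesis sparse_le : forall T : {set I}, T \subset P ->
  (forall i, i \in T -> (\sum_(j in T) d i j <= 2)%N) -> (#|T| <= s)%N.

Definition total_weight (J : {set I}) := (\sum_(i in J) \sum_(j in J) d i j)%N.

Lemma total_weightU (A B : {set I}) : [disjoint A & B] ->
  total_weight (A :|: B) =
  (total_weight A + (\sum_(i in B) \sum_(j in A) d i j).*2 + total_weight B)%N.
Proof.
move=> dAB.
have splitU (F : I -> nat) : (\sum_(i in A :|: B) F i = \sum_(i in A) F i + \sum_(i in B) F i)%N.
  by rewrite -bigU //; apply: eq_bigl => i; rewrite !inE.
rewrite /total_weight splitU (eq_bigr _ (fun i _ => splitU (d i))) big_split /=.
rewrite [X in (_ + X)%N](eq_bigr _ (fun i _ => splitU (d i))) big_split /=.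
rewrite [X in (_ + X + _)%N]exchange_big /=.
under [X in (_ + X + _)%N]eq_bigr do under eq_bigr do rewrite d_sym.
lia.
Qed.

Lemma total_weightU1 (A : {set I}) (i : I) : i \notin A ->
  total_weight (i |: A) = (total_weight A + (\sum_(j in A) d i j).*2)%N.
Proof.
move=> iA; rewrite setUC total_weightU; last by rewrite disjoint_sym disjoints1.
by rewrite /total_weight !big_set1 d_diag addn0.
Qed.

(* A maximiser of [5 |T| - total_weight T] has inner degrees at most 5/2 and
   outer degrees at least 5/2. *)
Lemma sparse_dominating (J : {set I}) : exists2 T : {set I}, T \subset J &
  (forall i, i \in T -> (\sum_(j in T) d i j <= 2)%N) /\
  (forall i, i \in J :\: T -> (3 <= \sum_(j in T) d i j)%N).
Proof.
(* Each pair is counted twice in [total_weight], so adding [i] changes [F] by 5 minus twice the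
   degree of [i]; by integrality the threshold 5/2 separates 2 from 3. *)
pose F (T : {set I}) : int := (5 * #|T|)%:Z - (total_weight T)%:Z.
have := @Order.TotalTheory.arg_maxP _ _ _ set0 (fun T : {set I} => T \subset J) F (sub0set J).
case=> T TJ Tmax; exists T => //; split=> i.
  move=> iT; have iD : i \notin T :\ i by rewrite !inE eqxx.
  have := Tmax (T :\ i) (subset_trans (subD1set _ _) TJ).
  have wT := total_weightU1 _ _ iD; have cT := cardsU1 i (T :\ i).
  rewrite (setD1K iT) iD in wT cT.
  by rewrite /F (big_setD1 i) //= d_diag wT cT; lia.
rewrite inE => /andP[iT iJ]; have := Tmax (i |: T).
rewrite subUset sub1set iJ TJ => /(_ isT).
by rewrite /F total_weightU1 // cardsU1 iT; lia.
Qed.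

(** Induction removing a set [T] given by [sparse_dominating]. In the expansion of
    [(#|T| + #|J :\: T|) ^ 2], the bound [#|T| <= s] handles the square of [#|T|], and the crossing
    weight, at least 3 per remaining block and counted twice, pays for the mixed term. *)
Lemma weighted_turan (J : {set I}) : J \subset P ->
  (3 * #|J| ^ 2 <= s * (3 * #|J| + total_weight J))%N.
Proof.
have [m] := ubnP #|J|; elim: m J => // m IHm J leJ JP.
have [->|[i0 i0J]] := set_0Vmem J; first by rewrite cards0.
have [T TJ [Tin Tout]] := sparse_dominating J.
have leT := sparse_le _ (subset_trans TJ JP) Tin.
have T_gt0 : (0 < #|T|)%N.
  rewrite card_gt0; apply/eqP => T0; have := Tout i0.
  by rewrite T0 setD0 big_set0 => /(_ i0J).
have cardJ : #|J| = (#|T| + #|J :\: T|)%N by rewrite -(cardsID T J) (setIidPr TJ).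
have := IHm (J :\: T); rewrite (subset_trans (subsetDl _ _) JP).
have -> : (#|J :\: T| < m)%N by lia.
move=> /(_ isT isT) IH.
have cross : (3 * #|J :\: T| <= \sum_(i in J :\: T) \sum_(j in T) d i j)%N.
  by rewrite mulnC -sum_nat_const; apply: leq_sum => i /Tout.
have -> : total_weight J = (total_weight T +
    (\sum_(i in J :\: T) \sum_(j in T) d i j).*2 + total_weight (J :\: T))%N.
  rewrite -total_weightU ?setUDl; last by rewrite disjoints_subset setDE setCI setCK subsetUr.
  by rewrite -{1}(setID J T) (setIidPr TJ).
rewrite cardJ; move: IH cross leT T_gt0; nia.
Qed.

End WeightedTuran.

(** * Certificates of flipped blocks and 0-sensitivity *)

Section Blocks.
Variables (n : nat) (f : input n -> bool) (x : input n).
Variables (P : {set {set 'I_n}}) (S : {set 'I_n} -> {set 'I_n}).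
Hypothesis fx : f x = false.
Hypothesis P_triv : trivIset P.
Hypothesis S_cert : forall B, B \in P -> forall y : input n,
  {in S B, y =1 flip x B} -> f y.

Lemma flipU1 (Y : {set 'I_n}) (e : 'I_n) : e \notin Y ->
  flip (flip x Y) [set e] = flip x (e |: Y).
Proof.
move=> eY; apply/ffunP => i; rewrite !ffunE !inE.
by case: eqP => [->|]//=; rewrite (negbTE eY).
Qed.

(** These are the positions of the certificate of [B] where [flip x X] and [flip x B] disagree. *)
Definition violated (B X : {set 'I_n}) := S B :&: (B :\: X :|: X :\: B).

Lemma violatedPn (B X : {set 'I_n}) (e : 'I_n) :
  e \in S B -> e \notin violated B X -> (e \in X) = (e \in B).
Proof. by rewrite !inE => ->; case: (e \in B); case: (e \in X). Qed.

(* Every block of [T] supplies a sensitive coordinate of a maximal 0-input [Y]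
   below [X]: either a coordinate of the block in [X :\: Y], or the one at which
   [Y] violates the certificate of the block. *)
Lemma card_le_s0 (T : {set {set 'I_n}}) (X : {set 'I_n}) (h : 'I_n -> {set 'I_n}) :
  T \subset P ->
  (forall B, B \in T -> (#|violated B X| <= 1)%N /\ {in violated B X, forall e, h e = B}) ->
  (#|T| <= s0 f)%N.
Proof.
move=> /subsetP TP viol.
have flip0 : flip x set0 = x by apply/ffunP => i; rewrite ffunE inE.
pose zero_below (Y : {set 'I_n}) := (Y \subset X) && ~~ f (flip x Y).
have : zero_below set0 by rewrite /zero_below sub0set flip0 fx.
case/maxset_exists=> Y /maxsetP[/andP[YX fY] Ymax] _.
apply: (@leq_trans (sens f (flip x Y))); last by rewrite /s0 leq_bigmax_cond.
(* The sensitive coordinates of [flip x Y] are mapped to blocks; it suffices that the image covers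
   [T]. *)
pose blame e := if e \in X :\: Y then pblock P e else h e.
apply: leq_trans (leq_imset_card blame _); apply: subset_leq_card.
apply/subsetP => B BT; have [viol1 hB] := viol B BT; have BP := TP B BT.
have sensitive e : f (flip (flip x Y) [set e]) ->
    e \in [set e | f (flip (flip x Y) [set e]) != f (flip x Y)].
  by rewrite inE => ->; rewrite (negbTE fY).
apply/imsetP; have [/subsetP BXY|/subsetPn[e]] := boolP (B :&: X \subset Y); last first.
  rewrite inE => /andP[eB eX] eY; exists e; last first.
    by rewrite /blame inE eY eX (def_pblock P_triv BP eB).
  apply: sensitive; rewrite flipU1 //; apply: contraNT eY => fe.
  rewrite -(Ymax (e |: Y)) ?setU11 ?subsetUr //.
  by rewrite /zero_below fe subUset sub1set eX YX.
(* Here [Y] agrees with [X] on [B] and is smaller outside, so no violation is new. One must remain,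
   since [flip x Y] is a 0-input, and flipping it restores the certificate. *)
have violYX : {subset violated B Y <= violated B X}.
  move=> e; rewrite !inE => /andP[-> /=]; have := BXY e; have := subsetP YX e.
  by rewrite inE; case: (e \in B); case: (e \in X); case: (e \in Y).
have [viol0|[e eviol]] := set_0Vmem (violated B Y).
  case/negP: fY; apply: (S_cert _ BP) => i iS.
  by rewrite !ffunE (@violatedPn B Y) // viol0 inE.
exists e; last first.
  rewrite /blame; case: ifP => [|_]; last by rewrite hB ?violYX.
  rewrite inE => /andP[eY eX]; move: eviol; rewrite !inE (negbTE eY) andbF orbF /= => /andP[_ eB].
  by case/negP: eY; apply: BXY; rewrite inE eB eX.
apply: sensitive; apply: (S_cert _ BP) => i iS; rewrite !ffunE inE.
case: eqP => [->|/eqP iNe].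
  by move: eviol; rewrite !inE => /andP[_]; case: (e \in B); case: (e \in Y) => //=; rewrite negbK.
rewrite (@violatedPn B Y) //; apply: contra iNe => iviol.
by apply/eqP; apply: (card_le1_eqP viol1); apply: violYX.
Qed.

(** Blocks serve as vertices and conflicting coordinates as edges; the weighted degrees bound the
    multigraph degrees, so [injective_endpoints] provides the charging. *)
Lemma sparse_card_le_s0 (T : {set {set 'I_n}}) : T \subset P ->
  (forall A, A \in T ->
     (\sum_(B in T) (A != B) * (#|S A :&: B| + #|S B :&: A|) <= 2)%N) ->
  (#|T| <= s0 f)%N.
Proof.
move=> TP deg; have T_triv := trivIsetS TP P_triv.
(* The certificates of these blocks require [e] to stay unflipped. *)
pose tails e := [set B in T | (e \in S B) && (e \notin B)].
pose K := [set e in cover T | tails e != set0].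
(* A coordinate with several tails can only be charged to its owner, which is
   encoded by a loop. *)
pose v e := pblock T e.
pose u e := if #|tails e| == 1%N then odflt (v e) [pick B in tails e] else v e.
have vT e : e \in K -> v e \in T by rewrite inE => /andP[eT _]; apply: pblock_mem.
have v_in e : e \in K -> e \in v e by rewrite inE mem_pblock => /andP[].
have v_eq e B : B \in T -> e \in B -> v e = B by move=> BT; apply: def_pblock.
have uP e : (#|tails e| = 1%N /\ tails e = [set u e]) \/ (#|tails e| != 1%N /\ u e = v e).
  rewrite /u; case: eqP => [e1|]; last by right.
  left; split=> //; case: pickP => [B Be|noB] /=.
    move/eqP/cards1P: e1 Be => [C ->]; by rewrite inE => /eqP ->.
  by move: e1; rewrite eq_card0.
have uT e : e \in K -> u e \in T.
  move=> eK; case: (uP e) => [[_ te]|[_ ->]]; last exact: vT.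
  by have : u e \in tails e by [rewrite te set11]; rewrite inE => /andP[].
have degK t : (\sum_(e in K) ((u e == t) + (v e == t)) <= 2)%N.
  have [tT|tNT] := boolP (t \in T); last first.
    rewrite big1 // => e eK; have := uT e eK; have := vT e eK.
    by case: eqP => [->|_]; case: eqP => [->|_]; rewrite ?(negbTE tNT).
  apply: leq_trans (deg t tT).
  have cardE (A B : {set 'I_n}) : (#|A :&: B| = \sum_e ((e \in A) && (e \in B)))%N.
    by rewrite -sum1_card big_mkcond; apply: eq_bigr => e _; rewrite inE; case: andP.
  have -> : (\sum_(B in T) (t != B) * (#|S t :&: B| + #|S B :&: t|) =
      \sum_e \sum_(B in T) (t != B) *
        (((e \in S t) && (e \in B)) + ((e \in S B) && (e \in t))))%N.
    rewrite exchange_big; apply: eq_bigr => B _ /=.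
    by rewrite -big_distrr big_split !cardE.
  rewrite big_mkcond; apply: leq_sum => e _; case: ifP => // eK.
  have [tv|tNv] := eqVneq (v e) t.
    have et : e \in t by rewrite -tv v_in.
    (* A loop contributes 2 to the degree but comes with at least two tails; a single tail differs
       from the owner [t] and contributes 1. *)
    apply: (@leq_trans #|tails e|).
      case: (uP e) => [[e1 te]|[eN1 ->]].
        have : u e \in tails e by rewrite te set11.
        by rewrite e1 inE; case: eqP => // ->; rewrite et !andbF.
      have : (0 < #|tails e|)%N by move: eK; rewrite inE card_gt0 => /andP[].
      by rewrite tv eqxx; lia.
    rewrite -sum1_card big_mkcond [X in (_ <= X)%N]big_mkcond; apply: leq_sum => B _.
    rewrite inE et; case: (B \in T) => //=; case: (e \in S B) => //=.
    case: (eqVneq t B) => [<-|_]; first by rewrite et.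
    by case: (e \in B); case: (e \in S t).
  rewrite addn0; case: eqP => // ut.
  have tt : t \in tails e.
    case: (uP e) => [[_ ->]|[_ uv]]; first by rewrite ut set11.
    by rewrite -uv ut eqxx in tNv.
  rewrite (bigD1 (v e)) ?vT //= eq_sym tNv v_in //.
  by move: tt; rewrite inE => /and3P[_ -> _].
have [h [hend hinj]] := injective_endpoints _ _ _ _ _ degK.
pose X := [set e in cover T | (e \in K) ==> (h e != v e)].
(* A violation inside [B] is a coordinate left out of [X], hence charged to its owner [B]; one
   outside [B] is flipped, hence charged to its only tail, which is [B]. *)
have violE B e : B \in T -> e \in violated B X -> e \in K /\ h e = B.
  move=> BT; rewrite !inE -/(v e) => /andP[eS /orP[/andP[eX eB]|/andP[eB /andP[eT eX]]]].
    have eT : e \in cover T by apply/bigcupP; exists B.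
    move: eX; rewrite eT /= negb_imply negbK => /andP[te /eqP ->].
    by rewrite (v_eq e B BT eB) te.
  have Be : B \in tails e by rewrite inE BT eS eB.
  have te : tails e != set0 by apply/set0Pn; exists B.
  have eK : e \in K by rewrite inE eT.
  move: eX; rewrite eT te /= => /negbTE hNv; split=> //.
  have := hend e eK; rewrite hNv orbF => /eqP he.
  case: (uP e) => [[_ tE]|[_ uv]]; last by rewrite he uv eqxx in hNv.
  by move: Be; rewrite tE inE he => /eqP ->.
apply: (card_le_s0 T X h TP) => B BT; split; last by move=> e /violE[].
apply/card_le1_eqP => e e' /violE-/(_ BT)[eK he] /violE-/(_ BT)[eK' he'].
by apply: hinj; rewrite ?he ?he'.
Qed.

End Blocks.

(** * Counting the conflicts *)

Theorem theorem3 (n : nat) (f : input n -> bool)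
  (hnc : exists x y : input n, f x != f y) :
  (C1 f)%:R >= (3%:R / 2%:R) * ((bs0 f)%:R / (s0 f)%:R) - 1 / 2%:R :> rat.
Proof.
case: (posnP (s0 f)) => [->|s0_gt0].
  (* Division by zero yields 0, leaving -1/2 as the lower bound. *)
  by rewrite invr0 !mulr0 sub0r; apply: le_trans (ler0n _ _); lra.
suff main : (3 * bs0 f <= s0 f * (2 * C1 f + 1))%N.
  have s0_gt0R : 0 < (s0 f)%:R :> rat by rewrite ltr0n.
  have mainR : (bs0 f)%:R / (s0 f)%:R <= (2 * (C1 f)%:R + 1) / 3 :> rat.
    rewrite ler_pdivrMr // mulrAC ler_pdivlMr // mulrC [_ * (s0 f)%:R]mulrC.
    by move: main; rewrite -(ler_nat rat) !natrM natrD natrM.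
  by lra.
have [x0 fx0] : exists x, ~~ f x.
  case: hnc => y [y']; case fy: (f y); case fy': (f y') => // _.
  - by exists y'; rewrite fy'.
  - by exists y; rewrite fy.
have [x fx ->] : {x | ~~ f x & bs0 f = bsens f x}.
  by apply: eq_bigmax_cond; apply/card_gt0P; exists x0.
have blocks0 : sens_blocks f x set0.
  rewrite /sens_blocks; apply/andP; split; last by apply/forall_inP => B; rewrite inE.
  by apply/trivIsetP => B; rewrite inE.
have [P /andP[P_triv /forall_inP P_sens] ->] :
    {P | sens_blocks f x P & bsens f x = #|P|}.
  by apply: eq_bigmax_cond; apply/card_gt0P; exists set0.
have f_flip B : B \in P -> f (flip x B).
  by move/P_sens; rewrite (negbTE fx); case: (f _).
have cert_ex y : exists S, is_cert f y S /\ #|S| = cert f y.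
  have certT : is_cert f y setT.
    apply/forallP => z; apply/implyP => /forall_inP zy.
    by have -> : z = y by apply/ffunP => i; apply/eqP/zy; rewrite inE.
  (* The default value [n] of the minimum is itself attained, by [setT]. *)
  rewrite /cert; elim/big_ind: _ => [|a b [A [? <-]] [B [? <-]]|S ?].
  - by exists setT; rewrite cardsT card_ord.
  - by rewrite /minn; case: ifP => _; [exists A | exists B].
  - by exists S.
have [Sy SyP] := fin_all_exists cert_ex.
pose S B := Sy (flip x B).
have S_card B : B \in P -> (#|S B| <= C1 f)%N.
  move=> BP; rewrite /S (SyP _).2 /C1.
  exact: (@leq_bigmax_cond _ (fun y => f y) (cert f)) (f_flip B BP).
have S_cert B : B \in P -> forall y : input n, {in S B, y =1 flip x B} -> f y.
  move=> BP y yS; have [/forallP/(_ y)/implyP cy _] := SyP (flip x B).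
  suff /cy/eqP -> : [forall i in S B, y i == flip x B i] by apply: f_flip.
  by apply/forall_inP => i iS; rewrite yS.
(* Otherwise [x] itself would satisfy the certificate of [flip x B]. *)
have S_meets B : B \in P -> (0 < #|S B :&: B|)%N.
  move=> BP; rewrite card_gt0; apply: contraNneq fx => SB0.
  apply: (S_cert _ BP) => i iS; rewrite ffunE; case: ifP => // iB.
  by have := in_set0 i; rewrite -SB0 inE iS iB.
pose d (A B : {set 'I_n}) := ((A != B) * (#|S A :&: B| + #|S B :&: A|))%N.
have d_sym A B : d A B = d B A by rewrite /d eq_sym addnC.
have d_diag A : d A A = 0%N by rewrite /d eqxx.
have fxF : f x = false by apply: negbTE.
have := weighted_turan _ d (s0 f) P d_sym d_diag
  (sparse_card_le_s0 _ _ _ _ _ fxF P_triv S_cert) P (subxx _).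
have meets A : A \in P -> (\sum_(B in P) #|S A :&: B| <= #|S A|)%N.
  move=> AP; have -> : (\sum_(B in P) #|S A :&: B| = #|S A :&: cover P|)%N.
    rewrite -sum1_card (eq_bigl (fun i => (i \in cover P) && (i \in S A))); last first.
      by move=> i; rewrite inE andbC.
    rewrite big_trivIset_cond //; apply: eq_bigr => B _; rewrite -sum1_card.
    by apply: eq_bigl => i; rewrite inE andbC.
  exact: subset_leq_card (subsetIl _ _).
(* The blocks are disjoint and [A] uses up at least one position of [S A], which is the source of
   the term -1 in [C1 f - 1]. *)
have out A : A \in P -> (\sum_(B in P) (A != B) * #|S A :&: B| + 1 <= C1 f)%N.
  move=> AP; apply: leq_trans (S_card A AP); apply: leq_trans (meets A AP).
  rewrite (big_setD1 A) //= eqxx mul0n add0n [X in (_ <= X)%N](big_setD1 A) //= addnC.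
  apply: leq_add; first exact: S_meets.
  by apply: leq_sum => B _; case: (A != B); rewrite ?mul1n.
have : (total_weight _ d P + 2 * #|P| <= 2 * (#|P| * C1 f))%N.
  have -> : total_weight _ d P =
      (2 * \sum_(A in P) \sum_(B in P) (A != B) * #|S A :&: B|)%N.
    rewrite mul2n -addnn /total_weight [X in (_ + X)%N]exchange_big -big_split /=.
    apply: eq_bigr => A _; rewrite -big_split; apply: eq_bigr => B _ /=.
    by rewrite /d mulnDr [B == A]eq_sym.
  rewrite -mulnDr leq_mul2l /= -[X in (_ + X <= _)%N]sum1_card -big_split /=.
  by rewrite -sum_nat_const; apply: leq_sum => A; apply: out.
(* Scaling by [s0 f] makes both bounds linear in the same monomials: they add up to
   [3 k^2 <= s k (2 c + 1)], from which [k] cancels. *)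
move=> /(leq_mul (leqnn (s0 f))) weight_le turan.
have [->|P_gt0] := posnP #|P|; first by rewrite muln0.
rewrite -(leq_pmul2l P_gt0); move: weight_le turan.
set k := #|P|; set w := total_weight _ _ _; set c := C1 f; set s := s0 f.
rewrite -mulnn; move: k w c s; clear; lia.
Qed.
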